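(* Let $\alpha\in(0,1)$, let $f_c(x)=\frac{1}{1+cx}$ for $c>0$, $x\ge0$, and set $$c_\alpha^-=\max\{c>0:\ f_c(x)\ge E_\alpha(-x)\ \text{for all }x\ge 0\},\qquad c_\alpha^+=\min\{c>0:\ E_\alpha(-x)\ge f_c(x)\ \text{for all }x\ge 0\}.$$ Then $c_\alpha^-=\Gamma(1+\alpha)^{-1}$ and $c_\alpha^+=\Gamma(1-\alpha)$. In other words, for every $\alpha\in(0,1)$ the uniform estimate $$\frac{1}{1+\Gamma(1-\alpha)x}\;\le\;E_\alpha(-x)\;\le\;\frac{1}{1+\Gamma(1+\alpha)^{-1}x}$$ holds for all $x\ge 0$, with optimal constants.
   Context: $E_\alpha$ is the classical Mittag-Leffler function, $E_\alpha(z)=\sum_{n\ge0}\frac{z^n}{\Gamma(1+\alpha n)}$, $z\in\mathbb{C}$. *)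

(* Defs.v *)
From HB Require Import structures.
From mathcomp Require Import all_boot all_order all_algebra.
From mathcomp Require Import all_classical all_reals all_analysis.

Set Implicit Arguments.
Unset Strict Implicit.
Unset Printing Implicit Defensive.

Import Order.TTheory GRing.Theory Num.Theory.
Import numFieldNormedType.Exports.

Local Open Scope classical_set_scope.
Local Open Scope ring_scope.

(* Euler's integral, meaningful for 0 < s only: for s <= 0 it diverges and
   [Rintegral] returns the junk value 0. *)
Definition Gamma (R : realType) (s : R) : R :=
  \int[lebesgue_measure]_(t in `]0, +oo[) (t `^ (s - 1) * expR (- t)).

(* Restriction of the entire function E_alpha to the real line; for 0 < alpha
   all the arguments of [Gamma] are positive. *)
Definition mittag_leffler (R : realType) (alpha z : R) : R :=
  limn (series (fun n : nat => z ^+ n / Gamma (1 + alpha * n%:R))).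

Definition hyperb (R : realType) (c x : R) : R := 1 / (1 + c * x).

Definition is_maximum (R : realType) (A : set R) (m : R) : Prop :=
  A m /\ ubound A m.

Definition is_minimum (R : realType) (A : set R) (m : R) : Prop :=
  A m /\ lbound A m.

(* Main.v *)
(* With u t := E_alpha (- t^alpha) and v := - u', Euler's Beta integral turns
   fractional integration of the power series term by term into the three
   convolution identities
     u t = int_0^t (t-s)^(-alpha) v s ds / Gamma (1 - alpha),
     1 - u t = int_0^t v s ds,
     1 - u t = int_0^t (t-s)^(alpha-1) u s ds / Gamma alpha.
   At a first zero T of v one would have u' T = - v T = 0; but the first
   identity shows that u T - u (T - h) <= - c h with c > 0, because
   the kernel decreases and the contribution of [T - h, T] is only
   O(h^(2-alpha)).  Hence v > 0 and u is decreasing.  Bounding the kernel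
   (t-s)^(-alpha) below by t^(-alpha) in the first identity gives the lower
   estimate, and bounding u s below by u t in the third gives the upper one.
   Optimality: u <= 1 in the third identity gives
   1 - u t <= t^alpha / Gamma (1 + alpha), which decides the behaviour at 0; and
   if u s >= 1 / (1 + c s^alpha), which is s^(-alpha) / c up to lower order, the
   third identity forces 1 >= Gamma (1 - alpha) / c as t -> oo. *)

Require Import Defs.
From HB Require Import structures.
From mathcomp Require Import all_boot all_order all_algebra.
From mathcomp Require Import all_classical all_reals all_analysis.
From mathcomp Require Import measurable_realfun ring lra.

Set Implicit Arguments.
Unset Strict Implicit.
Unset Printing Implicit Defensive.

Import Order.TTheory GRing.Theory Num.Theory.
Import numFieldNormedType.Exports.

Local Open Scope classical_set_scope.
Local Open Scope ring_scope.

(** * Affine change of variables for the Lebesgue integral *)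

(** Lebesgue measure is [r] times its push-forward under [x |-> r * x + c]: the two agree on
    half-open intervals, which determine it. *)
Lemma ge0_integral_affine (R : realType) (r c : R) (f : R -> \bar R) :
  0 < r -> measurable_fun [set: R] f -> (forall x, 0 <= f x)%E ->
  (\int[lebesgue_measure]_x f x =
   r%:E * \int[lebesgue_measure]_x f (r * x + c)%R)%E.
Proof.
move=> r0 mf f0.
pose phi : measurableTypeR R -> measurableTypeR R := fun x => r * x + c.
have mphi : measurable_fun setT phi.
  by apply: measurable_funD => //; exact: measurable_funM.
pose k : {nonneg R} := NngNum (ltW r0).
rewrite (@eq_measure_integral _ _ _ _
  (mscale k (pushforward lebesgue_measure phi))); last first.
  move=> A mA _; apply: lebesgue_measure_unique => // _ [[a b]] _ <-.
  rewrite -[RHS]/(r%:E * lebesgue_measure (phi @^-1` `]a, b]))%E.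
  have -> : phi @^-1` `]a, b] = `](a - c) / r, (b - c) / r]%classic.
    apply/seteqP; split => x /=; rewrite !in_itv /= /phi;
      by rewrite ltr_pdivrMr // ler_pdivlMr // ltrBlDr lerBrDr mulrC.
  rewrite !lebesgue_measure_itv /= !lte_fin ltr_pM2r ?invr_gt0 // ltrD2r.
  case: ifP => _; last by rewrite mule0.
  by rewrite -!EFinB -EFinM; congr EFin; field; rewrite gt_eqF.
by rewrite ge0_integral_mscale // ge0_integral_pushforward.
Qed.

(** * Truncated powers and their convolutions *)

Section TruncatedPower.
Context {R : realType}.
Implicit Types a b r s t x y : R.

(* Truncating the power at 0 turns integrals over ]0, t[ into integrals over the
   whole line, so that all convolutions share one domain. *)
Definition tpow a x : R := if 0 < x then x `^ (a - 1) else 0.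

Lemma tpow_ge0 a x : 0 <= tpow a x.
Proof. by rewrite /tpow; case: ifP => // _; exact: powR_ge0. Qed.

Lemma tpowE a x : 0 < x -> tpow a x = x `^ (a - 1).
Proof. by rewrite /tpow => ->. Qed.

Lemma tpow_le0 a x : x <= 0 -> tpow a x = 0.
Proof. by rewrite /tpow ltNge => ->. Qed.

Lemma tpowM a r x : 0 < r -> tpow a (r * x) = r `^ (a - 1) * tpow a x.
Proof.
move=> r0; rewrite /tpow pmulr_rgt0 //; case: ifPn => x0; last by rewrite mulr0.
by rewrite powRM // ltW.
Qed.

Lemma tpowD a b x : tpow (a + b) x = tpow a x * x `^ b.
Proof.
rewrite /tpow; case: ifPn => x0; last by rewrite mul0r.
by rewrite -powRD ?(gt_eqF x0) ?implybT // addrAC.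
Qed.

Lemma measurable_tpow a : measurable_fun [set: R] (tpow a).
Proof.
apply: measurable_fun_ifT => //.
exact: measurable_fun_ltr.
Qed.

Lemma measurable_tpowB a t : measurable_fun [set: R] (fun s => tpow a (t - s)).
Proof.
by apply: (measurableT_comp (measurable_tpow a)); exact: measurable_funB.
Qed.

(** At [t = 1] this is Euler's Beta integral. Values in the extended reals allow scaling and Tonelli
    before finiteness is known. *)
Definition Beta_conv a b t : \bar R :=
  (\int[lebesgue_measure]_s (tpow a (t - s) * tpow b s)%:E)%E.

Lemma Beta_conv_ge0 a b t : (0 <= Beta_conv a b t)%E.
Proof.
by apply: integral_ge0 => s _; rewrite lee_fin mulr_ge0 ?tpow_ge0.
Qed.

(** The substitution [s = t * s'] extracts [t * t^(a-1) * t^(b-1)]. For [t <= 0] the factors are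
    never both nonzero. *)
Lemma Beta_conv_scale a b t :
  Beta_conv a b t = ((tpow (a + b) t)%:E * Beta_conv a b 1)%E.
Proof.
case: (ltP 0 t) => t0; last first.
  rewrite tpow_le0 // mul0e /Beta_conv integral0_eq // => s _.
  case: (ltP 0 s) => s0; last by rewrite (tpow_le0 b s0) mulr0.
  by rewrite tpow_le0 ?mul0r // subr_le0 (le_trans t0 (ltW s0)).
etransitivity; first apply: (@ge0_integral_affine _ t 0) => //.
- apply/measurable_EFinP; apply: measurable_funM; first exact: measurable_tpowB.
  exact: measurable_tpow.
- by move=> s; rewrite lee_fin mulr_ge0 ?tpow_ge0.
under eq_integral => s _.
  rewrite addr0 (_ : t - t * s = t * (1 - s)); last by ring.
  rewrite !tpowM // mulrACA EFinM.
  over.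
rewrite ge0_integralZl_EFin //; last 3 first.
- by move=> s _; rewrite lee_fin mulr_ge0 ?tpow_ge0.
- apply/measurable_EFinP; apply: measurable_funM; first exact: measurable_tpowB.
  exact: measurable_tpow.
- by rewrite mulr_ge0 ?powR_ge0.
rewrite muleA -EFinM; congr (_%:E * _)%E.
rewrite tpowE // -{1}(powRr1 (ltW t0)) -!powRD ?(gt_eqF t0) ?implybT //.
by congr (_ `^ _); ring.
Qed.

End TruncatedPower.

(** * The Gamma function: finiteness, lower bounds, Euler's Beta formula *)

Section GammaFunction.
Context {R : realType}.
Implicit Types a b r s t x y : R.

Let mu := @lebesgue_measure R.

Definition eGamma a : \bar R := (\int[mu]_x (tpow a x * expR (- x))%:E)%E.

Lemma measurable_expRN : measurable_fun [set: R] (fun x : R => expR (- x)).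
Proof. by apply: measurableT_comp. Qed.

Lemma Gamma_fine a : Gamma a = fine (eGamma a).
Proof.
rewrite /Gamma /Rintegral /eGamma integral_mkcond; congr fine.
apply: eq_integral => x _; rewrite patchE mem_setE in_itv /= andbT /tpow.
by case: ifP => // _; rewrite mul0r.
Qed.

Lemma eGamma_ge0 a : (0 <= eGamma a)%E.
Proof. by apply: integral_ge0 => x _; rewrite lee_fin mulr_ge0 ?tpow_ge0 ?expR_ge0. Qed.

Lemma measurable_Gamma_integrand a :
  measurable_fun [set: R] (fun x : R => tpow a x * expR (- x)).
Proof. exact: measurable_funM (measurable_tpow a) measurable_expRN. Qed.

(* Tonelli for (x, y) |-> (x - y)^(a-1) y^(b-1) e^(-x). *)
Lemma eGammaM a b :
  (eGamma a * eGamma b = Beta_conv a b 1 * eGamma (a + b))%E.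
Proof.
pose f (z : R * R) : \bar R := (tpow a (z.1 - z.2) * tpow b z.2 * expR (- z.1))%:E.
have mf : measurable_fun [set: R * R] f.
  apply/measurable_EFinP; apply: measurable_funM; first apply: measurable_funM.
  - apply: (measurableT_comp (measurable_tpow a)).
    by apply: measurable_funB; [exact: measurable_fst|exact: measurable_snd].
  - by apply: (measurableT_comp (measurable_tpow b)); exact: measurable_snd.
  - by apply: (measurableT_comp measurable_expRN); exact: measurable_fst.
have f0 z : (0 <= f z)%E.
  by rewrite lee_fin !mulr_ge0 ?tpow_ge0 ?expR_ge0.
have := fubini_tonelli (m1 := mu) (m2 := mu) f mf f0.
have -> : (\int[mu]_x \int[mu]_y f (x, y) = Beta_conv a b 1 * eGamma (a + b))%E.
  rewrite /eGamma -ge0_integralZl //; last 3 first.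
  - by apply/measurable_EFinP; exact: measurable_Gamma_integrand.
  - by move=> x _; rewrite lee_fin mulr_ge0 ?tpow_ge0 ?expR_ge0.
  - exact: Beta_conv_ge0.
  apply: eq_integral => x _.
  transitivity (Beta_conv a b x * (expR (- x))%:E)%E.
    rewrite /Beta_conv -ge0_integralZr //.
    - by apply/measurable_EFinP; apply: measurable_funM;
        [exact: measurable_tpowB|exact: measurable_tpow].
    - by move=> s _; rewrite lee_fin mulr_ge0 ?tpow_ge0.
  by rewrite Beta_conv_scale EFinM [in RHS]muleA; congr (_ * _)%E; exact: muleC.
move=> ->.
rewrite muleC {2}/eGamma -ge0_integralZr //; last 3 first.
- by apply/measurable_EFinP; exact: measurable_Gamma_integrand.
- by move=> x _; rewrite lee_fin mulr_ge0 ?tpow_ge0 ?expR_ge0.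
- exact: eGamma_ge0.
apply: eq_integral => y _.
(* Translating by [y] in the inner integral recombines the exponentials:
   [e^(-y) * e^(-(x-y)) = e^(-x)]. *)
transitivity ((tpow b y * expR (- y))%:E *
   \int[mu]_x (tpow a (1 * x - y) * expR (- (1 * x - y)))%:E)%E.
  congr (_ * _)%E.
  rewrite /eGamma; etransitivity; first apply: (@ge0_integral_affine _ 1 (- y)) => //.
  - by apply/measurable_EFinP; exact: measurable_Gamma_integrand.
  - by move=> x; rewrite lee_fin mulr_ge0 ?tpow_ge0 ?expR_ge0.
  by rewrite mul1e.
rewrite -ge0_integralZl_EFin //; last 3 first.
- by move=> x _; rewrite lee_fin mulr_ge0 ?tpow_ge0 ?expR_ge0.
- apply/measurable_EFinP; apply: (measurableT_comp (measurable_Gamma_integrand a)).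
  by apply: measurable_funB => //; exact: measurable_funM.
- by rewrite mulr_ge0 ?tpow_ge0 ?expR_ge0.
apply: eq_integral => x _; rewrite /f /= mul1r -EFinM; congr EFin.
by rewrite mulrACA -expRD (mulrC (tpow b y)); congr (_ * expR _); ring.
Qed.

Lemma eGamma_ge a r c : 0 <= c -> 0 < r ->
  (forall x, r <= x <= r + 1 -> c <= x `^ (a - 1)) ->
  ((c * expR (- (r + 1)))%:E <= eGamma a)%E.
Proof.
move=> c0 r0 cx.
have -> : (c * expR (- (r + 1)))%:E =
    (\int[mu]_(x in `[r, (r + 1)%R]) (c * expR (- (r + 1)))%:E)%E.
  rewrite integral_cst //= lebesgue_measure_itv /= lte_fin ltrDl ltr01.
  by rewrite -EFinB addrAC subrr add0r mule1.
rewrite integral_mkcond /eGamma; apply: ge0_le_integral => //.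
- move=> x _; rewrite patchE; case: ifP => // _.
  by rewrite lee_fin mulr_ge0 ?expR_ge0.
- by apply: (measurable_restrictT _ _).1.
- by apply/measurable_EFinP; exact: measurable_Gamma_integrand.
move=> x _; rewrite patchE mem_setE in_itv /=; case: ifPn => [/andP[rx xr]|_].
  rewrite lee_fin tpowE ?(lt_le_trans r0) // ler_pM ?expR_ge0 ?cx ?rx //.
  by rewrite ler_expR lerN2.
by rewrite lee_fin mulr_ge0 ?tpow_ge0 ?expR_ge0.
Qed.

(** The interval is exhausted by the compact intervals [[1/(n+1), 1]], on which the primitive
    [x^a / a] bounds the integral by [1/a]. *)
Lemma integral_tpow01 a : 0 < a ->
  (\int[mu]_(x in `]0%R, 1%R]) (tpow a x)%:E < +oo)%E.
Proof.
move=> a0.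
pose F n : set R := [set` `[(n.+1%:R)^-1, 1]].
have F0 n x : F n x -> 0 < x.
  by rewrite /F /= in_itv /= => /andP[+ _]; apply: lt_le_trans; rewrite invr_gt0.
have -> : [set` `]0%R, 1%R]] = \bigcup_n F n.
  apply/seteqP; split => x /=.
    rewrite in_itv /= => /andP[x0 x1].
    exists (Num.truncn x^-1) => //; rewrite /F /= in_itv /= x1 andbT.
    by rewrite invf_ple ?posrE // ltW // truncnS_gt.
  move=> [n _] Fnx; rewrite in_itv /= (F0 n) //.
  by move: Fnx; rewrite /F /= in_itv /= => /andP[].
apply: (@le_lt_trans _ _ (a^-1)%:E); last exact: ltry.
have mF n : measurable (F n) by exact: measurable_itv.
have ndF : nondecreasing_seq F.
  apply/nondecreasing_seqP => n; rewrite subsetEset => x; rewrite /F /= !in_itv /=.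
  by move=> /andP[nx ->]; rewrite andbT (le_trans _ nx) // lef_pV2 ?posrE // ler_nat.
have mf n : measurable_fun (F n) (fun x : measurableTypeR R => (tpow a x)%:E).
  by apply/measurable_EFinP; apply: measurable_funTS; exact: measurable_tpow.
have f0 n (x : measurableTypeR R) : F n x -> (0 <= (tpow a x)%:E)%E.
  by move=> _; rewrite lee_fin tpow_ge0.
have := ge0_nondecreasing_set_cvg_integral (mu := @lebesgue_measure R) ndF mF mf f0.
apply: cvge_le.
apply: nearW => n; rewrite /F.
(* For [n = 0] the interval is a point, and the fundamental theorem of calculus requires distinct
   endpoints. *)
have [->|n0] := eqVneq n 0%N.
  by rewrite invr1 set_itv1 integral_set1 lee_fin invr_ge0 ltW.
have ninv : (n.+1%:R : R)^-1 < 1.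
  by rewrite invf_lt1 // ltr1n ltnS lt0n.
have n0' : 0 < (n.+1%:R : R)^-1 by rewrite invr_gt0.
pose G (x : R) := a^-1 * x `^ a.
have dG (x : R) : 0 < x -> is_derive x 1 G (x `^ (a - 1)).
  move=> x0; have := is_derive1_powR a x0 => dp.
  apply: is_derive_eq; rewrite /GRing.scale /= mulrA mulVf ?mul1r // gt_eqF //.
have -> : (\int[lebesgue_measure]_(x in `[n.+1%:R^-1%R, 1%R]) (tpow a x)%:E =
    \int[lebesgue_measure]_(x in `[n.+1%:R^-1%R, 1%R]) (x `^ (a - 1))%:E)%E.
  apply: eq_integral => x; rewrite inE /= in_itv /= => /andP[nx _].
  by rewrite tpowE // (lt_le_trans _ nx).
rewrite (@continuous_FTC2 _ _ G) //.
- rewrite -EFinB lee_fin /G powR1 mulr1 lerBlDr lerDl mulr_ge0 ?powR_ge0 //.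
  by rewrite invr_ge0 ltW.
- apply: derivable_within_continuous => x; rewrite in_itv /= => /andP[nx _].
  by apply: derivable_powR; rewrite in_itv /= andbT (lt_le_trans _ nx).
- have cG (x : R) : 0 < x -> {for x, continuous G}.
    by move=> x0; apply/differentiable_continuous/derivable1_diffP; case: (dG _ x0).
  split.
  + move=> x; rewrite in_itv /= => /andP[nx _].
    by have [] := dG x (lt_trans n0' nx).
  + by apply: cvg_at_right_filter; exact: cG.
  + by apply: cvg_at_left_filter; exact: cG.
- move=> x; rewrite in_itv /= => /andP[nx _].
  by rewrite derive1E; have [_ ->] := dG x (lt_trans n0' nx).
Qed.

Lemma tpow_le_exp a : exists2 C : R, 0 <= C &
  forall x, 1 <= x -> tpow a x * expR (- x) <= C * exponential_pdf 2^-1 x.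
Proof.
pose n := Num.truncn `|a|.
(* From [(x/2)^(n+1) / (n+1)! <= e^(x/2)]; half of the exponential absorbs the power, and the
   leading 2 cancels the rate [1/2] in the density. *)
exists (2 * (n.+1`!%:R * 2 ^+ n.+1)); first by rewrite !mulr_ge0 ?ler0n ?exprn_ge0.
move=> x x1; have x0 : 0 < x by exact: lt_le_trans x1.
rewrite tpowE // exponential_pdfE ?(ltW x0) // mulNr.
rewrite [in leLHS](_ : - x = - (2^-1 * x) + - (2^-1 * x)); last by field.
rewrite expRD mulrA mulrACA mulrA ler_wpM2r ?expR_ge0 //.
rewrite -mulrA.
have -> (y : R) : 2 * (2^-1 * y) = y by field.
rewrite expRN ler_pdivrMr ?expR_gt0 //.
apply: (@le_trans _ _ (x ^+ n.+1)).
  rewrite -powR_mulrn ?(ltW x0) // ler_powR //.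
  rewrite lerBlDr (le_trans (ler_norm a)) // (le_trans (ltW (truncnS_gt _))) //.
  by rewrite lerDl.
rewrite -ler_pdivrMl ?mulr_gt0 ?exprn_gt0 ?ltr0n ?fact_gt0 //.
apply: le_trans (@expR_ge1Dxn R (2^-1 * x) n _); last by rewrite mulr_ge0 // ltW.
rewrite exprMn exprVn (_ : _^-1 * _ = 2 ^- n.+1 * x ^+ n.+1 / n.+1`!%:R).
  by rewrite lerDr.
by rewrite invfM; ring.
Qed.

(** The integrand is dominated by the power on []0, 1]] plus a multiple of an exponential
    density. *)
Lemma eGamma_lty a : 0 < a -> (eGamma a < +oo)%E.
Proof.
move=> a0; have [C C0 aC] := tpow_le_exp a.
pose f x := (tpow a x)%:E.
apply: (@le_lt_trans _ _ (\int[mu]_x ((f \_ `]0%R, 1%R]) x +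
    (C * exponential_pdf 2^-1 x)%:E))%E).
  apply: ge0_le_integral => //.
  - by move=> x _; rewrite lee_fin mulr_ge0 ?tpow_ge0 ?expR_ge0.
  - by apply/measurable_EFinP; exact: measurable_Gamma_integrand.
  - apply: emeasurable_funD.
      apply: (measurable_restrictT _ _).1 => //; apply/measurable_EFinP.
      by apply: measurable_funTS; exact: measurable_tpow.
    apply/measurable_EFinP; apply: measurable_funM => //.
    exact: measurable_exponential_pdf.
  move=> x _; rewrite patchE mem_setE in_itv /=.
  case: (ltP 0 x) => x0 /=; last first.
    by rewrite add0e lee_fin tpow_le0 // mul0r mulr_ge0 // exponential_pdf_ge0 // invr_ge0.
  case: ifPn => [_|]; last by rewrite -ltNge add0e lee_fin => /ltW; exact: aC.
  rewrite -EFinD lee_fin -[leLHS]addr0 lerD //.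
    by rewrite ler_piMr ?tpow_ge0 // -expR0 ler_expR oppr_le0 ltW.
  by rewrite mulr_ge0 // exponential_pdf_ge0 // invr_ge0.
rewrite ge0_integralD //; last 4 first.
- by move=> x _; rewrite patchE; case: ifP => // _; rewrite lee_fin tpow_ge0.
- apply: (measurable_restrictT _ _).1 => //; apply/measurable_EFinP.
  by apply: measurable_funTS; exact: measurable_tpow.
- by move=> x _; rewrite lee_fin mulr_ge0 // exponential_pdf_ge0 // invr_ge0.
- apply/measurable_EFinP; apply: measurable_funM => //.
  exact: measurable_exponential_pdf.
rewrite -integral_mkcond lte_add_pinfty ?integral_tpow01 //.
under eq_integral do rewrite EFinM.
rewrite ge0_integralZl_EFin //; last 2 first.
- by move=> x _; rewrite lee_fin exponential_pdf_ge0 // invr_ge0.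
- by apply/measurable_EFinP; exact: measurable_exponential_pdf.
by rewrite integral_exponential_pdf ?invr_gt0 // mule1 ltry.
Qed.

Lemma Gamma_EFin a : 0 < a -> (Gamma a)%:E = eGamma a.
Proof.
move=> a0; rewrite Gamma_fine fineK // ge0_fin_numE ?eGamma_ge0 //.
exact: eGamma_lty.
Qed.

(** On [[r, r + 1]] one has [x <= 2 * r], so [x^(a-1) = x^a / x >= r^a / (2 * r)] whatever the sign
    of [a - 1]. With [r] fixed, this shows that Gamma outgrows every exponential in [a]. *)
Lemma Gamma_lb a r : 0 < a -> 1 <= r ->
  r `^ (a - 1) / 2 * expR (- (r + 1)) <= Gamma a.
Proof.
move=> a0 r1; have r0 : 0 < r by exact: lt_le_trans r1.
rewrite -lee_fin Gamma_EFin //; apply: eGamma_ge => //.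
  by rewrite mulr_ge0 ?powR_ge0 ?invr_ge0.
move=> x /andP[rx xr]; have x0 : 0 < x by exact: lt_le_trans rx.
rewrite !powRB ?(gt_eqF r0) ?(gt_eqF x0) ?implybT //.
rewrite (powRr1 (ltW r0)) (powRr1 (ltW x0)) -mulrA ler_pM ?powR_ge0 //.
- by rewrite -invfM invr_ge0 mulr_ge0 // ltW.
- by rewrite ge0_ler_powR ?nnegrE // ltW.
- by rewrite -invfM lef_pV2 ?posrE ?mulr_gt0 //; lra.
Qed.

Lemma Gamma_gt0 a : 0 < a -> 0 < Gamma a.
Proof.
move=> a0; apply: lt_le_trans (Gamma_lb a0 (lexx 1)).
by rewrite powR1 !mulr_gt0 ?invr_gt0 ?expR_gt0.
Qed.

Lemma Gamma1 : Gamma 1 = 1 :> R.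
Proof.
rewrite /Gamma /Rintegral integral_itv_obnd_cbnd; last first.
  apply/measurable_EFinP; apply: measurable_funM; apply: measurable_funTS.
    exact: measurable_powR.
  exact: measurable_expRN.
rewrite -[RHS]/(fine 1%E) -(@integral_exponential_pdf R 1) // integral_mkcond.
congr fine; apply: eq_integral => x _.
rewrite /exponential_pdf !patchE; case: ifP => // _.
by rewrite subrr powRr0 mulN1r.
Qed.

Lemma Beta_convE a b t : 0 < a -> 0 < b ->
  Beta_conv a b t = (Gamma a * Gamma b / Gamma (a + b) * tpow (a + b) t)%:E.
Proof.
move=> a0 b0; have ab0 : 0 < a + b by rewrite addr_gt0.
rewrite Beta_conv_scale EFinM muleC; congr (_ * _)%E.
have := eGammaM a b; rewrite -!Gamma_EFin // -EFinM.
(* Finiteness of the Beta integral comes from the product formula: an infinite value would make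
   [Gamma a * Gamma b] infinite. *)
case: (Beta_conv a b 1) (Beta_conv_ge0 a b 1) => [z| |] //= _.
  move=> [] ->; congr EFin; rewrite mulfK // gt_eqF // Gamma_gt0 //.
by rewrite gt0_mulye ?lte_fin ?Gamma_gt0.
Qed.

End GammaFunction.

(** * Power series with infinite radius of convergence *)

Section EntireSeries.
Context {R : realType}.
Implicit Types (c : R^nat) (x : R).

(* Equivalent to an infinite radius of convergence. *)
Definition entire_coef c := forall x, 0 <= x ->
  exists2 M : R, 0 <= M & forall n, `|c n| * x ^+ n <= M.

(** The coefficient bound at [2 * x] leaves a factor [2^(-n)], uniformly for [|y| <= x]. *)
Lemma entire_geometric c x : entire_coef c -> 0 <= x ->
  exists2 M : R, 0 <= M &
    forall (y : R) n, `|y| <= x -> `|c n * y ^+ n| <= M * 2^-1 ^+ n.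
Proof.
move=> ce x0; have [|M M0 cM] := ce (2 * x); first by rewrite mulr_ge0.
exists M => // y n yx; rewrite normrM normrX exprVn ler_pdivlMr ?exprn_gt0 //.
apply: le_trans (cM n); rewrite exprMn -mulrA ler_wpM2l //.
by rewrite mulrC ler_wpM2l ?exprn_ge0 // lerXn2r ?nnegrE.
Qed.

Lemma entire_cvg c x : entire_coef c -> cvgn (pseries c x).
Proof.
move=> ce; have [M M0 cM] := entire_geometric ce (normr_ge0 x).
apply: normed_cvg; apply: (@series_le_cvg _ _ (geometric M 2^-1)) => //.
- by move=> n /=.
- by move=> n /=; rewrite mulr_ge0 ?exprn_ge0.
- by move=> n /=; exact: cM.
- apply: is_cvg_geometric_series; rewrite ger0_norm //; lra.
Qed.

(** Uniformity in both [n] and [y] supplies the majorant for dominated convergence. *)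
Lemma entire_pseries_bound c x : entire_coef c -> 0 <= x ->
  exists2 M : R, 0 <= M & forall (y : R) n, `|y| <= x -> `|pseries c y n| <= M.
Proof.
move=> ce x0; have [M M0 cM] := entire_geometric ce x0.
exists (M / (1 - 2^-1)); first by rewrite divr_ge0 //; lra.
move=> y n yx; rewrite /pseries /series /=.
apply: le_trans (ler_norm_sum _ _ _) _.
have := @geometric_le_lim R n M 2^-1 M0.
rewrite ger0_norm // => /(_ _ _)/(le_trans _); apply; [|lra|lra].
by rewrite /series /=; apply: ler_sum => k _; exact: cM.
Qed.

(** Since [(n+1) * x^n <= (2 * (x+1))^(n+1)], the bound for [c] at [2 * (x+1)] suffices. *)
Lemma entire_pseries_diffs c : entire_coef c -> entire_coef (pseries_diffs c).
Proof.
move=> ce x x0; have [|M M0 cM] := ce (2 * (x + 1)).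
  by rewrite mulr_ge0 // addr_ge0.
exists M => // n; apply: le_trans (cM n.+1).
rewrite /pseries_diffs normrM normr_nat (mulrC _ `|c n.+1|) -mulrA ler_wpM2l //.
rewrite exprMn; apply: ler_pM; rewrite ?exprn_ge0 ?ler0n //.
  by rewrite -natrX ler_nat ltnW // ltn_expl.
apply: (@le_trans _ _ ((x + 1) ^+ n)).
  by rewrite lerXn2r ?nnegrE ?addr_ge0 // lerDl.
by rewrite exprS ler_peMl ?exprn_ge0 ?addr_ge0 // lerDr.
Qed.

Lemma entire_is_derive c x : entire_coef c ->
  is_derive x 1 (fun x => limn (pseries c x)) (limn (pseries (pseries_diffs c) x)).
Proof.
move=> ce; have ce' := entire_pseries_diffs ce.
apply: (@pseries_snd_diffs _ _ (`|x| + 1)); try exact: entire_cvg.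
  by apply: entire_cvg; exact: entire_pseries_diffs.
by rewrite [ltRHS]ger0_norm ?addr_ge0 // ltrDl.
Qed.

Lemma entire_continuous c : entire_coef c -> continuous (fun x => limn (pseries c x)).
Proof.
move=> ce x; apply/differentiable_continuous/derivable1_diffP.
by case: (entire_is_derive x ce).
Qed.

Lemma limn_pseries0 c : entire_coef c -> limn (pseries c 0) = c 0%N.
Proof.
move=> ce; apply/cvg_lim => //; rewrite -cvg_shiftS /=.
under eq_fun => n.
  rewrite /pseries /series /= big_nat_recl // expr0 mulr1 big1 ?addr0; last first.
    by move=> i _; rewrite expr0n mulr0.
  over.
exact: cvg_cst.
Qed.

Lemma limn_pseriesS c x : entire_coef c ->
  limn (pseries c x) = c 0%N + x * limn (pseries (fun n => c n.+1) x).
Proof.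
move=> ce; have ce1 : entire_coef (fun n => c n.+1).
  move=> y y0; have [|M M0 cM] := ce (y + 1); first by rewrite addr_ge0.
  exists M => // n; apply: le_trans (cM n.+1); rewrite ler_wpM2l //.
  apply: (@le_trans _ _ ((y + 1) ^+ n)).
    by rewrite lerXn2r ?nnegrE ?addr_ge0 // lerDl.
  by rewrite exprS ler_peMl ?exprn_ge0 ?addr_ge0 // lerDr.
apply/cvg_lim => //; rewrite -cvg_shiftS /=.
under eq_fun => n.
  rewrite /pseries /series /= big_nat_recl // expr0 mulr1.
  under eq_bigr do rewrite exprS mulrCA.
  rewrite -mulr_sumr.
  over.
apply: cvgD; first exact: cvg_cst.
by apply: cvgM; [exact: cvg_cst|exact: entire_cvg].
Qed.

End EntireSeries.

(** * Two-parameter Mittag-Leffler functions and fractional integration *)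

Section MittagLeffler.
Context {R : realType} (alpha : R).
Hypothesis alpha_gt0 : 0 < alpha.
Implicit Types a b r s t x y : R.

Let mu := @lebesgue_measure R.

(** Coefficients of the two-parameter function E_(alpha,b); [b = 1] gives the classical one. *)
Definition ml_coef b n := (Gamma (b + alpha * n%:R))^-1.

Let arg_gt0 b n : 0 < b -> 0 < b + alpha * n%:R.
Proof. by move=> b0; rewrite ltr_wpDr // mulr_ge0 // ltW. Qed.

Lemma entire_ml_coef b : 0 < b -> entire_coef (ml_coef b).
Proof.
(* This r makes the lower bound r^(alpha n) on Gamma equal to (x + 1)^n. *)
move=> b0 x x0; pose r := (x + 1) `^ alpha^-1.
have r1 : 1 <= r.
  rewrite /r -[leLHS](powRr0 (x + 1)) ler_powR ?lerDr //.
  by rewrite invr_ge0 ltW.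
have r0 : 0 < r by exact: lt_le_trans r1.
have rE n : r `^ (alpha * n%:R) = (x + 1) ^+ n.
  by rewrite /r -powRrM mulrA mulVf ?gt_eqF // mul1r powR_mulrn // addr_ge0.
pose C := r `^ (b - 1) / 2 * expR (- (r + 1)).
have C0 : 0 < C by rewrite mulr_gt0 ?expR_gt0 // mulr_gt0 ?invr_gt0 // powR_gt0.
exists C^-1; first by rewrite invr_ge0 ltW.
move=> n; have G0 := Gamma_gt0 (arg_gt0 n b0).
rewrite /ml_coef gtr0_norm ?invr_gt0 // ler_pdivrMl // ler_pdivlMr //.
apply: le_trans (Gamma_lb (arg_gt0 n b0) r1).
rewrite addrAC powRD ?(gt_eqF r0) ?implybT // rE.
rewrite [leRHS](_ : _ = (x + 1) ^+ n * C); last by rewrite /C; ring.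
by rewrite ler_wpM2r ?(ltW C0) // lerXn2r ?nnegrE ?addr_ge0 // lerDl.
Qed.

Definition ml b x := limn (pseries (ml_coef b) x).

(* t^(b-1) E_(alpha,b)(- t^alpha): mlfun 1 is u and mlfun alpha is v = - u'. *)
Definition mlfun b t := tpow b t * ml b (- (t `^ alpha)).

Lemma continuous_ml b : 0 < b -> continuous (ml b).
Proof. by move=> b0; apply: entire_continuous; exact: entire_ml_coef. Qed.

Lemma measurable_mlfun b : 0 < b -> measurable_fun [set: R] (mlfun b).
Proof.
move=> b0; apply: measurable_funM; first exact: measurable_tpow.
apply: (measurableT_comp (continuous_measurable_fun (continuous_ml b0))).
by apply: measurableT_comp => //; exact: measurable_powR.
Qed.

Lemma mlfun_le0 b t : t <= 0 -> mlfun b t = 0.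
Proof. by move=> t0; rewrite /mlfun tpow_le0 // mul0r. Qed.

Lemma tpow_pseries b s n :
  tpow b s * pseries (ml_coef b) (- (s `^ alpha)) n =
  \sum_(0 <= k < n) (-1) ^+ k * ml_coef b k * tpow (b + alpha * k%:R) s.
Proof.
rewrite /pseries /series /= mulr_sumr; apply: eq_bigr => k _.
rewrite tpowD (exprNn (s `^ alpha)) powRrM powR_mulrn ?powR_ge0 //.
by ring.
Qed.

Lemma Beta_integrable a b t : 0 < a -> 0 < b ->
  mu.-integrable setT (fun s => (tpow a (t - s) * tpow b s)%:E).
Proof.
move=> a0 b0; apply/integrableP; split.
  apply/measurable_EFinP; apply: measurable_funM; first exact: measurable_tpowB.
  exact: measurable_tpow.
under eq_integral do rewrite gee0_abs ?lee_fin ?mulr_ge0 ?tpow_ge0 //.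
by rewrite -/(Beta_conv a b t) Beta_convE // ltry.
Qed.

(** Fractional integration of order [a] raises the second parameter from [b] to [a + b]: partial
    sums are integrated term by term, and dominated convergence gives the limit. *)
Lemma mlfun_conv a b t : 0 < a -> 0 < b -> 0 < t ->
  mu.-integrable setT (fun s => (tpow a (t - s) * mlfun b s)%:E) /\
  \int[mu]_s (tpow a (t - s) * mlfun b s) = Gamma a * mlfun (a + b) t.
Proof.
move=> a0 b0 t0.
have ab0 : 0 < a + b by rewrite addr_gt0.
pose f_ n s := (tpow a (t - s) * (tpow b s * pseries (ml_coef b) (- (s `^ alpha)) n))%:E.
pose f s := (tpow a (t - s) * mlfun b s)%:E.
(* Arguments up to [t^alpha] in modulus suffice, because the integrand vanishes unless
   [0 < s < t]. *)
have [M M0 bM] := entire_pseries_bound (entire_ml_coef b0) (powR_ge0 t alpha).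
pose g s := (M%:E * (tpow a (t - s) * tpow b s)%:E)%E.
have f_E n s : f_ n s = (\sum_(0 <= k < n) ((-1) ^+ k * ml_coef b k)%:E *
    (tpow a (t - s) * tpow (b + alpha * k%:R) s)%:E)%E.
  rewrite /f_ tpow_pseries // mulr_sumr -sumEFin; apply: eq_bigr => k _.
  by rewrite -EFinM mulrCA.
have mB k : measurable_fun [set: R]
    (fun s => (tpow a (t - s) * tpow (b + alpha * k%:R) s)%:E).
  by apply: (measurable_int mu); apply: Beta_integrable => //; exact: arg_gt0.
have mf_ n : measurable_fun [set: R] (f_ n).
  rewrite (_ : f_ n = fun s => (\sum_(0 <= k < n) ((-1) ^+ k * ml_coef b k)%:E *
    (tpow a (t - s) * tpow (b + alpha * k%:R) s)%:E)%E); last exact/funext/f_E.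
  by apply: emeasurable_sum => k; apply: measurable_funeM.
have mf : measurable_fun [set: R] f.
  apply/measurable_EFinP; apply: measurable_funM; first exact: measurable_tpowB.
  exact: measurable_mlfun.
have [] := @dominated_convergence _ (measurableTypeR R) R mu setT measurableT f_ f g mf_ mf.
- apply: aeW => s _; apply: cvg_EFin; first exact: nearW.
  apply: cvgM; first exact: cvg_cst.
  apply: cvgM; first exact: cvg_cst.
  by apply: entire_cvg; exact: entire_ml_coef.
- by apply: integrableZl => //; exact: Beta_integrable.
- apply: aeW => s n _; rewrite /f_ /g -EFinM lee_fin.
  case: (ltP s t) => st; last by rewrite tpow_le0 ?subr_le0 // !mul0r normr0 mulr0.
  case: (ltP 0 s) => s0; last by rewrite (tpow_le0 b s0) !mul0r !mulr0 normr0.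
  rewrite mulrA normrM ger0_norm ?mulr_ge0 ?tpow_ge0 // mulrC.
  rewrite ler_wpM2r ?mulr_ge0 ?tpow_ge0 // bM // normrN ger0_norm ?powR_ge0 //.
  by rewrite ge0_ler_powR ?nnegrE // ltW.
move=> fi _ /= flim; split => //.
have : (\int[mu]_s f_ n s)%E @[n --> \oo] --> (Gamma a * mlfun (a + b) t)%:E.
  have -> : (fun n => \int[mu]_s f_ n s)%E = fun n =>
     (Gamma a * (tpow (a + b) t * pseries (ml_coef (a + b)) (- (t `^ alpha)) n))%:E.
    apply/funext => n.
    under eq_integral do rewrite f_E.
    rewrite integral_sum //; last first.
      by move=> k; apply: integrableZl => //; apply: Beta_integrable => //; exact: arg_gt0.
    rewrite tpow_pseries // mulr_sumr -sumEFin; apply: eq_bigr => k _.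
    rewrite integralZl //; last by apply: Beta_integrable => //; exact: arg_gt0.
    (* The Beta quotient replaces the coefficient [1 / Gamma (b + alpha k)] by
       [Gamma a / Gamma (a + b + alpha k)]. *)
    rewrite -/(Beta_conv a (b + alpha * k%:R) t) Beta_convE ?arg_gt0 // -EFinM.
    congr EFin; rewrite /ml_coef !addrA.
    by field; rewrite !gt_eqF // Gamma_gt0 // -?addrA ?arg_gt0 // addrA arg_gt0.
  apply: cvg_EFin; first exact: nearW.
  apply: cvgM; first exact: cvg_cst.
  apply: cvgM; first exact: cvg_cst.
  by apply: entire_cvg; exact: entire_ml_coef.
by move=> /(cvg_unique (@ereal_hausdorff R) flim); rewrite /Rintegral /f => ->.
Qed.

End MittagLeffler.

(** * Calculus of convergent integrals *)

Section Relaxation.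
Context {R : realType} (alpha : R).
Hypotheses (alpha_gt0 : 0 < alpha) (alpha_lt1 : alpha < 1).
Implicit Types a b c r s t x y : R.

Let mu := @lebesgue_measure R.

(** Integrability travels with the value, since linearity and monotonicity of the real-valued
    integral depend on it. *)
Definition has_integral (f : R -> R) (l : R) :=
  mu.-integrable setT (EFin \o f) /\ \int[mu]_s f s = l.

Lemma has_integralD f g l k : has_integral f l -> has_integral g k ->
  has_integral (fun s => f s + g s) (l + k).
Proof.
move=> [fi <-] [gi <-]; split; last by rewrite RintegralD.
by rewrite (_ : _ \o _ = (EFin \o f) \+ (EFin \o g))%E //; exact: integrableD.
Qed.

Lemma has_integralZ f l k : has_integral f l -> has_integral (fun s => k * f s) (k * l).
Proof.
move=> [fi <-]; split; last by rewrite RintegralZl.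
by rewrite (_ : _ \o _ = (fun s => k%:E * (EFin \o f) s))%E //; exact: integrableZl.
Qed.

Lemma has_integralB f g l k : has_integral f l -> has_integral g k ->
  has_integral (fun s => f s - g s) (l - k).
Proof.
move=> fl /(has_integralZ (-1)); rewrite mulN1r => /(has_integralD fl).
by under eq_fun do rewrite mulN1r.
Qed.

Lemma has_integral_le f g l k : has_integral f l -> has_integral g k ->
  (forall s, f s <= g s) -> l <= k.
Proof. by move=> [fi <-] [gi <-] fg; apply: le_Rintegral. Qed.

Lemma has_integral_tpow a b t : 0 < a -> 0 < b ->
  has_integral (fun s => tpow a (t - s) * tpow b s)
    (Gamma a * Gamma b / Gamma (a + b) * tpow (a + b) t).
Proof.
move=> a0 b0; split; first exact: Beta_integrable.
by rewrite /Rintegral -/(Beta_conv a b t) Beta_convE.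
Qed.

(** * The three convolution identities *)

Let alphaC_gt0 : 0 < 1 - alpha. Proof. by rewrite subr_gt0. Qed.

Local Notation u := (mlfun alpha 1).
Local Notation v := (mlfun alpha alpha).

Lemma tpow1 t : 0 < t -> tpow 1 t = 1.
Proof. by move=> t0; rewrite tpowE // subrr powRr0. Qed.

(** Splitting off the constant term 1 of E_alpha leaves [- t^alpha] times the series with parameter
    [1 + alpha]. *)
Lemma mlfun_step t : 0 < t -> mlfun alpha (1 + alpha) t = 1 - u t.
Proof.
move=> t0; rewrite /mlfun tpowD tpow1 // !mul1r /ml.
rewrite [in RHS]limn_pseriesS; last exact: entire_ml_coef.
have -> : ml_coef alpha 1 0 = 1 by rewrite /ml_coef mulr0 addr0 Gamma1 invr1.
rewrite (_ : (fun n => _) = ml_coef alpha (1 + alpha)); last first.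
  by apply/funext => n; rewrite /ml_coef -natr1 mulrDr mulr1 addrA addrAC.
by rewrite opprD addrA subrr add0r mulNr opprK.
Qed.

(** With [v = - u'] this is the Caputo relaxation equation D^alpha u = - u in integral form. *)
Lemma conv_alphaC t : 0 < t ->
  has_integral (fun s => tpow (1 - alpha) (t - s) * v s) (Gamma (1 - alpha) * u t).
Proof.
move=> t0; have := mlfun_conv alpha_gt0 alphaC_gt0 alpha_gt0 t0.
by rewrite subrK.
Qed.

Lemma conv_one t : 0 < t -> has_integral (fun s => tpow 1 (t - s) * v s) (1 - u t).
Proof.
move=> t0; have := mlfun_conv alpha_gt0 ltr01 alpha_gt0 t0.
by rewrite Gamma1 mul1r mlfun_step.
Qed.

Lemma conv_alpha t : 0 < t ->
  has_integral (fun s => tpow alpha (t - s) * u s) (Gamma alpha * (1 - u t)).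
Proof.
move=> t0; have := mlfun_conv alpha_gt0 alpha_gt0 ltr01 t0.
by rewrite addrC mlfun_step.
Qed.

(** The integrand is the indicator of []0, t[], in the form needed for comparison with the
    convolutions. *)
Lemma conv_indic t : 0 <= t -> has_integral (fun s => tpow 1 (t - s) * tpow 1 s) t.
Proof.
move=> t0; split; first exact: Beta_integrable.
have -> : (fun s => tpow 1 (t - s) * tpow 1 s) = (cst 1 : R -> R) \_ `]0, t[.
  apply/funext => s; rewrite patchE mem_setE in_itv /=.
  case: (ltP 0 s) => s0 /=; last by rewrite (tpow_le0 _ s0) mulr0.
  case: (ltP s t) => st; last by rewrite tpow_le0 ?mul0r // subr_le0.
  by rewrite !tpow1 ?subr_gt0 // mulr1.
rewrite -Rintegral_mkcond Rintegral_cst // mul1r.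
rewrite -[LHS]/(fine (lebesgue_measure [set` `]0%R, t[])) lebesgue_measure_itv /= lte_fin.
case: ifPn => [_|]; first by rewrite /= subr0.
by rewrite -leNgt => t0'; apply/esym/eqP; rewrite eq_le t0' t0.
Qed.

(** * Local behaviour of [v] *)

(** The series factor tends to [1 / Gamma alpha > 0] at 0, and [s^(alpha-1) >= 1] for
    [0 < s <= 1]. *)
Lemma mlfun_ge_near0 : exists2 d, 0 < d & exists2 m, 0 < m &
  forall s, 0 < s <= d -> m <= v s.
Proof.
pose g := ml_coef alpha alpha 0.
have g0 : 0 < g by rewrite /g /ml_coef invr_gt0 Gamma_gt0 // mulr0 addr0.
have := continuous_ml alpha_gt0 alpha_gt0 (x := 0).
rewrite /continuous_at {2}/ml limn_pseries0; last exact: entire_ml_coef.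
move=> /(@cvgrPdist_lt _ R^o) /(_ (g / 2)) /(_ (divr_gt0 g0 (ltr0Sn _ _))).
move=> /nbhs_ballP[e /= e0 eg].
(* The second entry ensures [s^alpha <= e / 2], inside the ball of continuity. *)
pose d := Num.min 1 ((e / 2) `^ alpha^-1).
have d0 : 0 < d by rewrite lt_min ltr01 powR_gt0 // divr_gt0.
exists d => //; exists (g / 2); first by rewrite divr_gt0.
move=> s /andP[s0]; rewrite le_min => /andP[s1 se].
have sa : s `^ alpha <= e / 2.
  have -> : e / 2 = ((e / 2) `^ alpha^-1) `^ alpha.
    by rewrite -powRrM mulVf ?lt0r_neq0 // powRr1 // ltW // divr_gt0.
  by rewrite ge0_ler_powR ?nnegrE ?powR_ge0 // ltW.
have := eg (- (s `^ alpha)); rewrite /ball /= sub0r opprK ger0_norm ?powR_ge0 //.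
have sae : s `^ alpha < e by rewrite (le_lt_trans sa) // gtr_pMr // invf_lt1 // ltr1n.
move=> /(_ sae); rewrite -/g ltr_norml => /andP[_ gm].
have gml : g / 2 <= ml alpha alpha (- s `^ alpha) by lra.
rewrite /mlfun tpowE // -[leLHS]mul1r ler_pM ?ler01 ?divr_ge0 ?(ltW g0) //.
by rewrite -[leLHS](powRr0 s) ger_powR ?s0 // subr_le0 ltW.
Qed.

Lemma derivable_mlfun b t : 0 < b -> 0 < t -> derivable (mlfun alpha b) t 1.
Proof.
move=> b0 t0.
apply: (@near_eq_derivable _ _ _ (fun s => s `^ (b - 1) * ml alpha b (- (s `^ alpha)))) => //.
  by near=> s; rewrite /mlfun tpowE //; near: s; exact: lt_nbhsr.
apply: derivableM; first by apply: derivable_powR; rewrite in_itv /= andbT.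
apply/derivable1_diffP.
apply: (@differentiable_comp _ _ _ _ (fun s => - (s `^ alpha)) (ml alpha b)).
  apply/derivable1_diffP; apply: derivableN.
  by apply: derivable_powR; rewrite in_itv /= andbT.
apply/derivable1_diffP.
by have [] := entire_is_derive (- (t `^ alpha)) (entire_ml_coef alpha_gt0 b0).
Unshelve. end_near. Qed.

Lemma derivable_locally_lipschitz (f : R -> R) t : derivable f t 1 ->
  exists2 C, 0 <= C & exists2 d, 0 < d &
    forall s, `|s - t| < d -> `|f s - f t| <= C * `|s - t|.
Proof.
move=> /cvg_ex[l /= fl].
exists (`|l| + 1); first by rewrite addr_ge0.
move: fl => /(@cvgrPdist_lt _ R^o) /(_ 1 ltr01).
rewrite /dnbhs /= near_withinE => /nbhs_ballP[d /= d0 df].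
exists d => // s sd.
have [->|st] := eqVneq s t; first by rewrite !subrr normr0 mulr0.
have := df (s - t); rewrite /ball /= sub0r normrN => /(_ sd).
rewrite subr_eq0 => /(_ st); rewrite /GRing.scale /= mulr1 subrK => q.
rewrite -ler_pdivrMr ?normr_gt0 ?subr_eq0 // -normf_div.
rewrite [X in `|X|](_ : _ = l - (l - (s - t)^-1 * (f s - f t))); last by ring.
by rewrite (le_trans (ler_normB _ _)) // lerD2l ltW.
Qed.

(* Convexity: 1 - x <= e^(-x) with x = (q - p) / q. *)
Lemma powR_diff_ge (p q T : R) : 0 < p -> p < q -> q <= T ->
  q `^ (- alpha) + alpha * T `^ (- alpha - 1) * (q - p) <= p `^ (- alpha).
Proof.
move=> p0 pq qT; have q0 : 0 < q by exact: lt_trans pq.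
have T0 : 0 < T by exact: lt_le_trans qT.
have lnpq : ln p <= ln q - (q - p) / q.
  have : ln (1 + (p / q - 1)) <= p / q - 1.
    by apply: le_ln1Dx; rewrite ltrBrDl subrr divr_gt0.
  rewrite addrC subrK ln_div ?posrE // => h.
  have -> : (q - p) / q = 1 - p / q by field; rewrite gt_eqF.
  lra.
apply: (@le_trans _ _ (q `^ (- alpha) * expR (alpha * ((q - p) / q)))); last first.
  rewrite /powR !gt_eqF // -expRD ler_expR.
  have := ler_wpM2l (ltW alpha_gt0) lnpq; lra.
have h := expR_ge1Dx (alpha * ((q - p) / q)).
apply: le_trans (ler_wpM2l (powR_ge0 _ _) h).
rewrite [leRHS]mulrDr mulr1 lerD2l.
rewrite [leRHS](_ : _ = alpha * q `^ (- alpha - 1) * (q - p)).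
  rewrite ler_wpM2r ?subr_ge0 ?(ltW pq) // ler_wpM2l ?(ltW alpha_gt0) //.
  rewrite -!opprD !(powRN _ (alpha + 1)) lef_pV2 ?posrE ?powR_gt0 //.
  by rewrite ge0_ler_powR ?nnegrE ?addr_ge0 // ltW.
rewrite powRB ?(gt_eqF q0) ?implybT // powRr1 ?(ltW q0) //; ring.
Qed.

(** * Positivity of [v] *)

(** If [v T = 0], comparing the convolutions at [T] and [T - h] bounds a positive constant times [h]
    by O(h^(2-alpha)) + O(h^2), which fails for small [h]. *)
Lemma mlfun_no_first_zero (T : R) : 0 < T ->
  (forall s, 0 < s < T -> 0 < v s) -> v T != 0.
Proof.
(* The final elimination in abstract form: [x = u T], [y = u (T - h)], [w = 1 - u (T - h)],
   [p = h^(1-alpha)], [l = m * d']. *)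
have collect (G x y k h w C p l : R) : G * x <= G * y - k * h * w + C * p * h ->
    k * h * l <= k * h * w -> G * (y - x) <= G * (C * h * h) ->
    k * l * h <= C * p * h + G * C * h * h.
  by move=> *; lra.
move=> T0 vpos; apply/negP => /eqP vT.
have [C C0 [d d0 vlip]] := derivable_locally_lipschitz (derivable_mlfun alpha_gt0 T0).
have [e e0 [m m0 vm]] := mlfun_ge_near0.
(* The least steepness of [x^(-alpha)] on []0, T]]. *)
pose k := alpha * T `^ (- alpha - 1).
have k0 : 0 < k by rewrite mulr_gt0 ?powR_gt0.
(* For [h <= T / 2] this keeps []0, d'[] inside []0, T - h[], where [v >= m] on it gives mass
   [m * d'] independent of [h]. *)
pose d' := Num.min e (T / 2).
have d'0 : 0 < d' by rewrite lt_min e0 divr_gt0.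
have d'T : d' <= T / 2 by rewrite ge_min lexx orbT.
have v_ge0 s : s < T -> 0 <= v s.
  case: (ltP 0 s) => s0 sT; last by rewrite mlfun_le0.
  by rewrite ltW // vpos // s0.
have v_le s h : 0 < s -> s < T -> T - s <= h -> h < d -> v s <= C * (T - s).
  move=> s0 sT sh hd.
  have TsE : `|s - T| = T - s by rewrite distrC ger0_norm // subr_ge0 ltW.
  have := vlip s; rewrite TsE vT subr0 => /(_ (le_lt_trans sh hd)).
  exact: le_trans (ler_norm _).
have main h : 0 < h -> h <= T / 2 -> h < d ->
    k * (m * d') <= C * h `^ (1 - alpha) + Gamma (1 - alpha) * C * h.
  move=> h0 hT hd.
  have Th0 : 0 < T - h by rewrite subr_gt0 (le_lt_trans hT) // gtr_pMr // invf_lt1 // ltr1n.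
  have ThT : T - h <= T by rewrite lerBlDr lerDl ltW.
  have d'Th : d' <= T - h.
    rewrite (le_trans d'T) // lerBrDr (le_trans (lerD (lexx _) hT)) //.
    by rewrite -splitr.
  have w_lb : m * d' <= 1 - u (T - h).
    apply: has_integral_le (has_integralZ m (conv_indic (ltW d'0))) (conv_one Th0) _ => s.
    case: (ltP 0 s) => s0; last by rewrite (tpow_le0 1 s0) mlfun_le0 // !mulr0.
    case: (ltP s d') => sd'; last first.
      rewrite (tpow_le0 1 (_ : d' - s <= 0)) ?subr_le0 // mul0r mulr0.
      case: (ltP s (T - h)) => sT; last by rewrite tpow_le0 ?mul0r // subr_le0.
      by rewrite mulr_ge0 ?tpow_ge0 // v_ge0 // (lt_le_trans sT).
    rewrite !tpow1 ?subr_gt0 // ?(lt_le_trans sd') // !mulr1 mul1r vm // s0 /=.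
    by rewrite (le_trans (ltW sd')) // ge_min lexx.
  (* The difference of the indicators is that of [[T - h, T[]; its multiples majorize the
     contributions of this last strip. *)
  have := has_integralB (conv_indic (ltW T0)) (conv_indic (ltW Th0)).
  have -> : T - (T - h) = h by ring.
  move=> indic.
  have Bnd s (K : R) : 0 <= K ->
    0 <= K * (tpow 1 (T - s) * tpow 1 s - tpow 1 (T - h - s) * tpow 1 s).
    move=> K0; case: (ltP 0 s) => s0; last by rewrite (tpow_le0 1 s0) !mulr0 subr0 mulr0.
    rewrite mulr_ge0 // subr_ge0 ler_wpM2r ?tpow_ge0 //.
    case: (ltP s (T - h)) => sT; last by rewrite tpow_le0 ?tpow_ge0 // subr_le0.
    by rewrite !tpow1 ?subr_gt0 // (lt_le_trans sT).
  (* v = O(h) on [T - h, T], as v T = 0 and v is differentiable at T *)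
  have u_le : u (T - h) - u T <= C * h * h.
    have := has_integral_le (has_integralB (conv_one T0) (conv_one Th0))
      (has_integralZ (C * h) indic).
    rewrite (_ : 1 - u T - _ = u (T - h) - u T); last by ring.
    apply => s.
    case: (ltP 0 s) => s0; last by rewrite mlfun_le0 // !mulr0 subr0 Bnd // mulr_ge0 // ltW.
    case: (ltP s T) => sT; last first.
      rewrite (tpow_le0 1 (_ : T - s <= 0)) ?subr_le0 //.
      rewrite (tpow_le0 1 (_ : T - h - s <= 0)) ?subr_le0 ?(le_trans ThT) //.
      by rewrite !mul0r subr0 mulr0.
    case: (ltP s (T - h)) => sTh; first by rewrite !tpow1 ?subr_gt0 // subrr subrr mulr0.
    rewrite (tpow_le0 1 (_ : T - h - s <= 0)) ?subr_le0 // !mul0r !subr0.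
    rewrite !tpow1 ?subr_gt0 // !mulr1 mul1r.
    have Tsh : T - s <= h by rewrite lerBlDr addrC -lerBlDr.
    by rewrite (le_trans (v_le s h _ _ _ _)) // ler_wpM2l.
  (* Before [T - h] the kernel drops by at least [k * h]; on the strip, [(T-s)^(-alpha) * v s <= C *
     (T-s)^(1-alpha) <= C * h^(1-alpha)]. *)
  have key : Gamma (1 - alpha) * u T <= Gamma (1 - alpha) * u (T - h) -
      k * h * (1 - u (T - h)) + C * h `^ (1 - alpha) * h.
    have := has_integral_le (conv_alphaC T0)
      (has_integralD (has_integralB (conv_alphaC Th0) (has_integralZ (k * h) (conv_one Th0)))
      (has_integralZ (C * h `^ (1 - alpha)) indic)).
    apply => s.
    have Ch : 0 <= C * h `^ (1 - alpha) by rewrite mulr_ge0 ?powR_ge0.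
    case: (ltP 0 s) => s0; last by rewrite mlfun_le0 // !mulr0 subr0 add0r Bnd.
    case: (ltP s T) => sT; last first.
      rewrite (tpow_le0 _ (_ : T - s <= 0)) ?subr_le0 //.
      rewrite (tpow_le0 _ (_ : T - h - s <= 0)) ?subr_le0 ?(le_trans ThT) //.
      rewrite (tpow_le0 _ (_ : T - s <= 0)) ?subr_le0 //.
      rewrite (tpow_le0 _ (_ : T - h - s <= 0)) ?subr_le0 ?(le_trans ThT) //.
      by rewrite !mul0r !mulr0 !subr0 mulr0 addr0.
    case: (ltP s (T - h)) => sTh.
      rewrite !tpow1 ?subr_gt0 // subrr mulr0 addr0 mul1r.
      rewrite -mulrBl ler_wpM2r ?v_ge0 // !tpowE ?subr_gt0 //.
      have -> : 1 - alpha - 1 = - alpha by ring.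
      rewrite lerBrDr.
      have := @powR_diff_ge (T - h - s) (T - s) T.
      have -> : T - s - (T - h - s) = h by ring.
      by apply; rewrite ?subr_gt0 // ?lerBlDr ?lerDl ?ltW // ltrD2r ltrBlDr ltrDl.
    rewrite (tpow_le0 _ (_ : T - h - s <= 0)) ?subr_le0 //.
    rewrite (tpow_le0 1 (_ : T - h - s <= 0)) ?subr_le0 // !mul0r mulr0 !subr0 add0r.
    rewrite !tpow1 ?subr_gt0 // !mulr1 tpowE ?subr_gt0 //.
    have Tsh : T - s <= h by rewrite lerBlDr addrC -lerBlDr.
    have Ts0 : 0 < T - s by rewrite subr_gt0.
    apply: (@le_trans _ _ ((T - s) `^ (1 - alpha - 1) * (C * (T - s)))).
      by rewrite ler_wpM2l ?powR_ge0 // (v_le s h).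
    rewrite mulrCA ler_wpM2l // [leLHS]mulrC mulr_powRB1 ?(ltW Ts0) //.
    by rewrite ge0_ler_powR ?nnegrE // ltW.
  rewrite -(ler_pM2r h0) mulrDl.
  have G0 : 0 < Gamma (1 - alpha) by exact: Gamma_gt0.
  apply: collect key _ _; first by rewrite ler_wpM2l // ltW // mulr_gt0.
  by rewrite ler_wpM2l // ltW.
have lim : (C * h `^ (1 - alpha) + Gamma (1 - alpha) * C * h) @[h --> 0^'+] --> 0.
  rewrite -[X in _ --> X]addr0 -[X in _ --> X + _](mulr0 C).
  rewrite -[X in _ --> _ + X](mulr0 (Gamma (1 - alpha) * C)).
  apply: cvgD; apply: cvgM; try exact: cvg_cst.
    exact: powR_cvg0.
  by apply: cvg_at_right_filter; exact: cvg_id.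
have kmd : 0 < k * (m * d') by rewrite mulr_gt0 // mulr_gt0.
suff : k * (m * d') <= 0 by rewrite leNgt kmd.
apply: (cvgr_to_ge lim).
near=> h; apply: main => //.
by near: h; apply: nbhs_right_le; rewrite divr_gt0.
Unshelve. all: end_near. Qed.

(** Let [T] be the infimum of the points where [v <= 0]; it is positive by the bound near 0. By
    continuity, [v T < 0] contradicts positivity to the left of [T], and [v T > 0] contradicts that
    such points approach [T]. *)
Lemma mlfun_alpha_gt0 t : 0 < t -> 0 < v t.
Proof.
move=> t0; rewrite ltNge; apply/negP => vt.
pose S : set R := [set s | 0 < s /\ v s <= 0].
have [e e0 [m m0 vm]] := mlfun_ge_near0.
have eS : lbound S e.
  move=> s [s0 vs]; rewrite leNgt; apply/negP => se.
  by have := vm s; rewrite s0 (ltW se) => /(_ isT); rewrite leNgt (le_lt_trans vs m0).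
have St : S t by [].
have infS : has_inf S by split; [exists t|exists e].
pose T := inf S.
have T0 : 0 < T by rewrite (lt_le_trans e0) // lb_le_inf //; exists t.
have vpos s : 0 < s < T -> 0 < v s.
  move=> /andP[s0 sT]; rewrite ltNge; apply/negP => vs.
  have : T <= s by apply: ge_inf; [case: infS|].
  by rewrite leNgt sT.
have cv : {for T, continuous v}.
  exact/differentiable_continuous/derivable1_diffP/derivable_mlfun.
have := mlfun_no_first_zero T0 vpos; rewrite neq_lt => /orP[vT|vT].
  have : \forall s \near T, v s < 0.
    exact: (cvgr_lt (v T) cv).
  move=> /nbhs_ballP[r /= r0 rv].
  (* Half the minimum keeps [s] both positive and within [r] of [T]. *)
  pose s := T - Num.min r T / 2.
  have r'0 : 0 < Num.min r T by rewrite lt_min r0.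
  have sT : s < T by rewrite /s ltrBlDr ltrDl divr_gt0.
  have rT : Num.min r T <= T by rewrite ge_min lexx orbT.
  have rr : Num.min r T <= r by rewrite ge_min lexx.
  have s0 : 0 < s by rewrite /s; lra.
  have : v s < 0.
    by apply: rv; rewrite /ball /= /s opprB addrC subrK gtr0_norm ?divr_gt0 //; lra.
  by rewrite ltNge ltW // vpos // s0.
have : \forall s \near T, 0 < v s.
  exact: (cvgr_gt (v T) cv).
move=> /nbhs_ballP[r /= r0 rv].
have [s [s0 vs] sTr] := inf_adherent r0 infS.
have Ts : T <= s by apply: ge_inf; [case: infS|].
have : 0 < v s.
  apply: rv; rewrite /ball /= distrC ger0_norm ?subr_ge0 //.
  by rewrite ltrBlDl.
by rewrite ltNge vs.
Qed.

Lemma mlfun_alpha_ge0 t : 0 <= v t.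
Proof.
by case: (ltP 0 t) => t0; [exact/ltW/mlfun_alpha_gt0|rewrite mlfun_le0].
Qed.

(** * Monotonicity and bounds for [u] *)

Lemma mlfun1_nonincreasing s t : 0 < s -> s <= t -> u t <= u s.
Proof.
move=> s0 st; have t0 : 0 < t by exact: lt_le_trans st.
suff : 1 - u s <= 1 - u t by rewrite lerD2l lerN2.
apply: has_integral_le (conv_one s0) (conv_one t0) _ => r.
rewrite ler_wpM2r ?mlfun_alpha_ge0 //.
case: (ltP r s) => rs; last by rewrite tpow_le0 ?tpow_ge0 // subr_le0.
by rewrite !tpow1 ?subr_gt0 // (lt_le_trans rs).
Qed.

Lemma mlfun1_le1 t : 0 < t -> u t <= 1.
Proof.
move=> t0; have [_ I] := conv_one t0; rewrite -subr_ge0 -I.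
by apply: Rintegral_ge0 => s _; rewrite mulr_ge0 ?tpow_ge0 ?mlfun_alpha_ge0.
Qed.

(** The kernel integral [t^alpha / alpha], written so that [Gamma alpha] cancels against the third
    convolution identity. *)
Lemma conv_alpha_cst t : 0 < t ->
  has_integral (fun s => tpow alpha (t - s) * tpow 1 s)
    (Gamma alpha * (t `^ alpha / Gamma (1 + alpha))).
Proof.
move=> t0; have := has_integral_tpow t alpha_gt0 ltr01.
rewrite Gamma1 mulr1 addrC tpowD tpow1 // mul1r.
by rewrite -mulrA (mulrC _ (t `^ alpha)).
Qed.

Lemma mlfun1_upper t : 0 < t ->
  u t * (t `^ alpha / Gamma (1 + alpha)) <= 1 - u t.
Proof.
move=> t0; have Ga := Gamma_gt0 alpha_gt0.
have := has_integral_le (has_integralZ (u t) (conv_alpha_cst t0)) (conv_alpha t0).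
rewrite mulrCA ler_pM2l //; apply => s.
rewrite mulrCA; case: (ltP s t) => st; last first.
  by rewrite (tpow_le0 alpha (_ : t - s <= 0)) ?subr_le0 // !mul0r.
rewrite ler_wpM2l ?tpow_ge0 //.
case: (ltP 0 s) => s0; last by rewrite (tpow_le0 _ s0) (mlfun_le0 _ _ s0) mulr0.
by rewrite tpow1 // mulr1 mlfun1_nonincreasing // ltW.
Qed.

Lemma mlfun1_linear t : 0 < t -> 1 - u t <= t `^ alpha / Gamma (1 + alpha).
Proof.
move=> t0; have Ga := Gamma_gt0 alpha_gt0.
have := has_integral_le (conv_alpha t0) (conv_alpha_cst t0).
rewrite ler_pM2l //; apply => s; rewrite ler_wpM2l ?tpow_ge0 //.
case: (ltP 0 s) => s0; last by rewrite tpow_le0 // mlfun_le0.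
by rewrite tpow1 // mlfun1_le1.
Qed.

Lemma mlfun1_ge t : 0 < t -> 1 - u t <= t `^ alpha * Gamma (1 - alpha) * u t.
Proof.
move=> t0; have ta := powR_gt0 alpha t0.
have := has_integral_le (has_integralZ (t `^ (- alpha)) (conv_one t0)) (conv_alphaC t0).
rewrite powRN ler_pdivrMl // mulrA; apply => s.
case: (ltP 0 s) => s0; last by rewrite mlfun_le0 // !mulr0.
rewrite mulrA ler_wpM2r ?mlfun_alpha_ge0 //.
case: (ltP s t) => st; last by rewrite !tpow_le0 ?mulr0 // subr_le0.
rewrite tpow1 ?subr_gt0 // mulr1 tpowE ?subr_gt0 //.
have -> : 1 - alpha - 1 = - alpha by ring.
rewrite powRN lef_pV2 ?posrE ?powR_gt0 ?subr_gt0 //.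
rewrite ge0_ler_powR ?nnegrE ?(ltW alpha_gt0) ?(ltW t0) //.
  by rewrite subr_ge0 ltW.
by rewrite lerBlDr lerDl ltW.
Qed.

Lemma mlfun1_ge0 t : 0 < t -> 0 <= u t.
Proof.
move=> t0; have [_ I] := conv_alphaC t0.
rewrite -(pmulr_rge0 _ (Gamma_gt0 alphaC_gt0)) -I.
by apply: Rintegral_ge0 => s _; rewrite mulr_ge0 ?tpow_ge0 ?mlfun_alpha_ge0.
Qed.

(** * Transfer to E_alpha through [t = x^(1/alpha)] *)

Lemma mittag_lefflerE x : mittag_leffler alpha x = ml alpha 1 x.
Proof.
rewrite /mittag_leffler /ml /pseries; congr (limn (series _)).
by apply/funext => n; rewrite /ml_coef mulrC.
Qed.

Lemma mittag_leffler0 : mittag_leffler alpha 0 = 1.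
Proof.
rewrite mittag_lefflerE /ml limn_pseries0; last exact: entire_ml_coef.
by rewrite /ml_coef mulr0 addr0 Gamma1 invr1.
Qed.

Lemma mlfun1E t : 0 < t -> u t = mittag_leffler alpha (- (t `^ alpha)).
Proof. by move=> t0; rewrite mittag_lefflerE /mlfun tpow1 // mul1r. Qed.

Lemma powR_alphaV x : 0 < x -> (x `^ alpha^-1) `^ alpha = x.
Proof. by move=> x0; rewrite -powRrM mulVf ?lt0r_neq0 // powRr1 // ltW. Qed.

Lemma mittag_leffler_upper x : 0 <= x ->
  mittag_leffler alpha (- x) <= 1 / (1 + (Gamma (1 + alpha))^-1 * x).
Proof.
have G0 : 0 < (Gamma (1 + alpha))^-1 by rewrite invr_gt0 Gamma_gt0 // addr_gt0.
(* The point [x = 0] is separate: [mlfun] is truncated to 0 there, while E_alpha(0) = 1. *)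
rewrite le_eqVlt => /predU1P[<-|x0].
  by rewrite oppr0 mittag_leffler0 mulr0 addr0 divr1.
have t0 : 0 < x `^ alpha^-1 by rewrite powR_gt0.
have := mlfun1_upper t0; rewrite mlfun1E // powR_alphaV // => h.
rewrite ler_pdivlMr ?addr_gt0 ?mulr_gt0 //; lra.
Qed.

Lemma mittag_leffler_lower x : 0 <= x ->
  1 / (1 + Gamma (1 - alpha) * x) <= mittag_leffler alpha (- x).
Proof.
have G0 : 0 < Gamma (1 - alpha) by exact: Gamma_gt0.
rewrite le_eqVlt => /predU1P[<-|x0].
  by rewrite oppr0 mittag_leffler0 mulr0 addr0 divr1.
have t0 : 0 < x `^ alpha^-1 by rewrite powR_gt0.
have := mlfun1_ge t0; rewrite mlfun1E // powR_alphaV // => h.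
rewrite ler_pdivrMr ?addr_gt0 ?mulr_gt0 //; lra.
Qed.

Lemma mittag_leffler_linear x : 0 < x ->
  1 - x / Gamma (1 + alpha) <= mittag_leffler alpha (- x).
Proof.
move=> x0; have t0 : 0 < x `^ alpha^-1 by rewrite powR_gt0.
have := mlfun1_linear t0; rewrite mlfun1E // powR_alphaV // => h.
by rewrite lerBlDr -lerBlDl.
Qed.

(** * Optimality of the constants *)

Lemma upper_const_le c : 0 < c ->
  (forall x, 0 <= x -> mittag_leffler alpha (- x) <= hyperb c x) ->
  c <= (Gamma (1 + alpha))^-1.
Proof.
move=> c0 ub; set g := (Gamma (1 + alpha))^-1.
have g0 : 0 < g by rewrite invr_gt0 Gamma_gt0 // addr_gt0.
rewrite leNgt; apply/negP => gc.
have gc0 : 0 < g * c by rewrite mulr_gt0.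
(* With this [x], [(1 - g x) * (1 + c x) = 1 + x * (c - g) / 2 > 1], so the hyperbola falls below
   the linear bound. *)
have [x x0 cx] : exists2 x, 0 < x & g * c * x = (c - g) / 2.
  exists ((c - g) / (2 * (g * c))); first by rewrite divr_gt0 ?subr_gt0 // mulr_gt0.
  by field; rewrite !gt_eqF.
have := le_trans (mittag_leffler_linear x0) (ub x (ltW x0)).
rewrite -/g mulrC /hyperb ler_pdivlMr ?addr_gt0 ?mulr_gt0 //.
have -> : (1 - g * x) * (1 + c * x) = 1 + x * (c - g - g * c * x) by ring.
rewrite gerDl cx leNgt => /negP; apply; apply: mulr_gt0 x0 _; lra.
Qed.

(* The remainder exponent alpha + e is to be chosen < 1, so that s^(- alpha - e)
   stays integrable at 0. *)
Lemma hyperb_powR_ge c e s : 0 < c -> 0 < e -> e <= alpha -> 0 < s ->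
  c^-1 * s `^ (- alpha) - (1 + c^-1) / c * s `^ (- alpha - e) <=
  hyperb c (s `^ alpha).
Proof.
move=> c0 e0 ea s0.
pose y := s `^ alpha; pose z := s `^ e.
have y0 : 0 < y by exact: powR_gt0.
have z0 : 0 < z by exact: powR_gt0.
have zy : z <= 1 + y.
  case: (leP s 1) => s1.
    rewrite (@le_trans _ _ 1) ?lerDl ?(ltW y0) // /z -[leRHS](powRr0 s).
    by rewrite ger_powR ?s0 // ltW.
  by rewrite (@le_trans _ _ y) ?lerDr // ler_powR // ltW.
rewrite powRB ?(gt_eqF s0) ?implybT // !powRN -/y -/z /hyperb.
have cy0 : 0 < 1 + c * y by rewrite addr_gt0 ?mulr_gt0.
rewrite ler_pdivlMr //.
(* The constant [(1 + 1/c) / c] is chosen so that the claim reduces to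
   [z <= (1 + 1/c) * (1 + c * y)], which follows from [z <= 1 + y]. *)
have -> : (c^-1 / y - (1 + c^-1) / c * (y^-1 / z)) * (1 + c * y) =
  1 + (c * y * z)^-1 * (z - (1 + c^-1) * (1 + c * y)).
  by field; rewrite !gt_eqF.
rewrite gerDl mulr_ge0_le0 ?invr_ge0 ?(ltW (mulr_gt0 _ _)) ?mulr_gt0 // subr_le0.
have -> : (1 + c^-1) * (1 + c * y) = 1 + y + (c^-1 + c * y).
  by field; rewrite gt_eqF.
by rewrite (le_trans zy) // lerDl addr_ge0 ?invr_ge0 ?mulr_ge0 // ltW.
Qed.

(** The main term [s^(-alpha) / c] convolves to a constant in [t], because the Beta exponents
    [alpha] and [1 - alpha] sum to 1; the remainder decays like [t^(-e)]. *)
Lemma lower_const_ge c : 0 < c ->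
  (forall x, 0 <= x -> hyperb c x <= mittag_leffler alpha (- x)) ->
  Gamma (1 - alpha) <= c.
Proof.
move=> c0 lb.
(* The first entry permits the hyperbola estimate; the second keeps [1 - alpha - e] positive. *)
pose e := Num.min alpha ((1 - alpha) / 2).
have e0 : 0 < e by rewrite lt_min alpha_gt0 divr_gt0.
have ea : e <= alpha by rewrite ge_min lexx.
have ea1 : e <= (1 - alpha) / 2 by rewrite ge_min lexx orbT.
have b0 : 0 < 1 - alpha - e by lra.
have e1 : 0 < 1 - e by lra.
have Ga := Gamma_gt0 alpha_gt0.
pose K := (1 + c^-1) / c; have K0 : 0 < K by rewrite divr_gt0 ?addr_gt0 ?invr_gt0.
pose L := K * Gamma (1 - alpha - e) / Gamma (1 - e).
have L0 : 0 < L.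
  by apply: divr_gt0; [apply: mulr_gt0 K0 _|]; exact: Gamma_gt0.
suff : c^-1 * Gamma (1 - alpha) <= 1 by rewrite ler_pdivrMl // mulr1.
suff main t : 0 < t -> c^-1 * Gamma (1 - alpha) - L * t `^ (- e) <= 1.
  apply/ler_addgt0Pr => d d0.
  have Ld0 : 0 < L / d := divr_gt0 L0 d0.
  (* At [t = (L/d)^(1/e)] the remainder [L * t^(-e)] equals [d]. *)
  have := main _ (powR_gt0 e^-1 Ld0).
  rewrite powRN -powRrM mulVf ?(lt0r_neq0 e0) // (powRr1 (ltW Ld0)).
  by rewrite invf_div mulrCA (mulfV (lt0r_neq0 L0)) mulr1 lerBlDr.
move=> t0.
have := has_integral_le (has_integralB
   (has_integralZ c^-1 (has_integral_tpow t alpha_gt0 alphaC_gt0))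
   (has_integralZ K (has_integral_tpow t alpha_gt0 b0))) (conv_alpha t0).
have -> : alpha + (1 - alpha) = 1 by ring.
have -> : alpha + (1 - alpha - e) = 1 - e by ring.
rewrite Gamma1 divr1 tpow1 // mulr1 [tpow _ t]tpowE //.
have -> : 1 - e - 1 = - e by ring.
move=> h; have {h} : Gamma alpha * (c^-1 * Gamma (1 - alpha) - L * t `^ (- e)) <=
    Gamma alpha * (1 - u t).
  rewrite [leLHS](_ : _ = c^-1 * (Gamma alpha * Gamma (1 - alpha)) -
    K * (Gamma alpha * Gamma (1 - alpha - e) / Gamma (1 - e) * t `^ (- e))).
    apply: h => s; case: (ltP 0 s) => s0; last first.
      by rewrite !(tpow_le0 _ s0) (mlfun_le0 _ _ s0) !mulr0 subr0.
    rewrite mulrCA [K * _]mulrCA -mulrBr ler_wpM2l ?tpow_ge0 //.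
    rewrite !tpowE // mlfun1E //.
    have -> : 1 - alpha - 1 = - alpha by ring.
    have -> : 1 - alpha - e - 1 = - alpha - e by ring.
    apply: le_trans (lb _ (powR_ge0 _ _)).
    exact: hyperb_powR_ge.
  by rewrite /L; ring.
rewrite ler_pM2l // => /le_trans; apply.
by rewrite gerBl mlfun1_ge0.
Qed.

End Relaxation.

Theorem theorem4 (R : realType) (alpha : R)
    (alpha_gt0 : 0 < alpha) (alpha_lt1 : alpha < 1) :
  [/\ is_maximum
        [set c : R | 0 < c /\
          forall x : R, 0 <= x -> hyperb c x >= mittag_leffler alpha (- x)]
        (Gamma (1 + alpha))^-1,
      is_minimum
        [set c : R | 0 < c /\
          forall x : R, 0 <= x -> mittag_leffler alpha (- x) >= hyperb c x]
        (Gamma (1 - alpha))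
    & forall x : R, 0 <= x ->
        1 / (1 + Gamma (1 - alpha) * x) <= mittag_leffler alpha (- x) /\
        mittag_leffler alpha (- x) <= 1 / (1 + (Gamma (1 + alpha))^-1 * x)].
Proof.
split.
- split => /=.
    split; first by rewrite invr_gt0 Gamma_gt0 // addr_gt0.
    by move=> x x0; exact: mittag_leffler_upper.
  by move=> c [c0 ub]; exact: upper_const_le.
- split => /=.
    split; first by rewrite Gamma_gt0 // subr_gt0.
    by move=> x x0; exact: mittag_leffler_lower.
  by move=> c [c0 lb]; exact: (lower_const_ge alpha_gt0 alpha_lt1).
- by move=> x x0; split; [exact: mittag_leffler_lower|exact: mittag_leffler_upper].
Qed.
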